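(* There exist a sequence $\beta = (\beta_n)_{n\geq 0}$ of positive numbers such that $\sum_{n=0}^\infty \frac{1}{\beta_n} < +\infty$ and $\beta_{n+1}/\beta_n \to 1$ as $n \to \infty$, and a symbol $\varphi$ such that $\varphi \in H^2(\beta)$ and $\|\varphi\|_\infty < 1$, but $C_\varphi$ is not bounded on $H^2(\beta)$.
   Context: $\mathbb{D}$ is the open unit disk of $\mathbb{C}$, and $\|\varphi\|_\infty = \sup_{z\in\mathbb{D}} |\varphi(z)|$. For a sequence $\beta = (\beta_n)_{n\geq 0}$ of positive numbers with $\liminf_{n\to\infty} \beta_n^{1/n} \geq 1$, the weighted Hardy space $H^2(\beta)$ is the Hilbert space of analytic functions $f(z) = \sum_{n=0}^\infty a_n z^n$ on $\mathbb{D}$ such that $\|f\|^2 := \sum_{n=0}^\infty |a_n|^2 \beta_n < +\infty$. A symbol is a non-constant analytic map $\varphi\colon \mathbb{D} \to \mathbb{D}$; its composition operator is $C_\varphi(f) = f\circ\varphi$. $C_\varphi$ is bounded on $H^2(\beta)$ if it maps $H^2(\beta)$ into itself and is a bounded operator there. *)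

(* Defs.v *)
From Stdlib Require Export Reals.
From Coquelicot Require Export Coquelicot.

Open Scope R_scope.

(* Functions on the open unit disk are represented by total functions
   [C -> C]; every notion below only looks at their values on the disk
   (complex differentiability at a point of the open disk is local). *)

Definition in_disk (z : C) : Prop := Cmod z < 1.

Definition analytic_on_disk (f : C -> C) : Prop :=
  forall z : C, in_disk z -> @ex_derive C_AbsRing C_NormedModule f z.

Definition sup_norm (f : C -> C) : Rbar :=
  Lub_Rbar (fun x : R => exists z : C, in_disk z /\ x = Cmod (f z)).

(* The term of index 0 of the sequence is a dummy value, which does not
   affect the lower limit. *)
Definition weight (beta : nat -> R) : Prop :=
  (forall n : nat, 0 < beta n) /\
  Rbar_le 1 (LimInf_seq (fun n => Rpower (beta n) (/ INR n))).

Definition taylor_on_disk (f : C -> C) (a : nat -> C) : Prop :=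
  forall z : C, in_disk z -> @is_pseries C_AbsRing C_NormedModule a z (f z).

(* [H2_norm beta f r]: [f] belongs to H^2(beta) and its norm is [r].  The
   norm is given as a relation, since the Taylor coefficients of [f] are
   only determined by [f] through the identity theorem. *)
Definition H2_norm (beta : nat -> R) (f : C -> C) (r : R) : Prop :=
  analytic_on_disk f /\
  exists a : nat -> C,
    taylor_on_disk f a /\
    ex_series (fun n => (Cmod (a n)) ^ 2 * beta n) /\
    r = sqrt (Series (fun n => (Cmod (a n)) ^ 2 * beta n)).

Definition in_H2 (beta : nat -> R) (f : C -> C) : Prop :=
  exists r : R, H2_norm beta f r.

Definition symbol (phi : C -> C) : Prop :=
  analytic_on_disk phi /\
  (forall z : C, in_disk z -> in_disk (phi z)) /\
  (exists z w : C, in_disk z /\ in_disk w /\ phi z <> phi w).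

Definition composition_operator (phi f : C -> C) : C -> C :=
  fun z => f (phi z).

Definition bounded_on_H2 (beta : nat -> R) (T : (C -> C) -> (C -> C)) : Prop :=
  (forall f : C -> C, in_H2 beta f -> in_H2 beta (T f)) /\
  (exists M : R, forall (f : C -> C) (r s : R),
     H2_norm beta f r -> H2_norm beta (T f) s -> s <= M * r).

(* Main.v *)
Require Import Defs.
From Stdlib Require Import Lra Lia.

(** The weight is chosen so that H^2(beta) is not an algebra.  If
    [beta (2 n) >= beta n ^ 4] for infinitely many [n], then
    [phi = delta * sum_n z^n / beta n] lies in H^2(beta), because
    [sum_n / beta n] converges, but [phi^2 = C_phi(z^2)] does not: all the
    coefficients being positive, that of [z^(2n)] is at least
    [(delta / beta n)^2], and its square times [beta (2 n)] is at least
    [delta^4] infinitely often.  Such a growth is compatible with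
    [beta (n+1) / beta n -> 1] when [ln (beta n)] oscillates on a logarithmic
    scale: for [ln (beta n) = sqrt n * (2 - cos (PI * log_2 n))] the increments
    are O(1 / sqrt n), while [ln (beta n) = sqrt n] and
    [ln (beta (2 n)) = 3 * sqrt (2 n) >= 4 * sqrt n] at [n = 4^k]. *)

(** * Series in normed modules and in [C] *)

Section NormedSeries.
Context {K : AbsRing} {V : NormedModule K}.

Lemma is_series_single (u : nat -> V) (N : nat) :
  (forall n, n <> N -> u n = zero) -> is_series u (u N).
Proof.
intros Hu.
assert (H0 : forall n, (n < N)%nat -> sum_n u n = zero).
{ induction n as [|n IH]; intros Hn.
  - rewrite sum_O. apply Hu. lia.
  - rewrite sum_Sn, IH by lia. rewrite (Hu (S n)) by lia. apply plus_zero_l. }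
assert (H1 : forall n, (N <= n)%nat -> sum_n u n = u N).
{ induction n as [|n IH]; intros Hn.
  - assert (N = 0)%nat by lia. subst. apply sum_O.
  - rewrite sum_Sn. destruct (Nat.eq_dec N (S n)) as [->|Hne].
    + rewrite H0 by lia. apply plus_zero_l.
    + rewrite IH by lia. rewrite (Hu (S n)) by lia. apply plus_zero_r. }
apply filterlim_ext_loc with (fun _ => u N).
- exists N. intros n Hn. symmetry. now apply H1.
- apply filterlim_const.
Qed.

Lemma norm_series_le (u : nat -> V) (l : V) (v : nat -> R) (s : R) :
  (forall n, norm (u n) <= v n) -> is_series u l -> is_series v s ->
  norm l <= s.
Proof.
intros Huv Hu Hv.
apply (is_lim_seq_le (fun n => norm (sum_n u n)) (sum_n v) (norm l) s).
- intros n. eapply Rle_trans. apply norm_sum_n_m. now apply sum_n_m_le.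
- eapply filterlim_comp. apply Hu. apply filterlim_norm.
- apply Hv.
Qed.

End NormedSeries.

(** A ball of [C_NormedModule] is a product of two real balls, so the partial sums converge exactly
    when their components do. This reduces complex series to real ones. *)
Lemma is_series_C (u : nat -> C) (l : C) :
  @is_series C_AbsRing C_NormedModule u l <->
  is_series (fun n => Re (u n)) (Re l) /\ is_series (fun n => Im (u n)) (Im l).
Proof.
assert (HR : forall n, Re (@sum_n C_NormedModule u n) = sum_n (fun n => Re (u n)) n).
{ induction n as [|n IH]. now rewrite !sum_O. now rewrite !sum_Sn, <- IH. }
assert (HI : forall n, Im (@sum_n C_NormedModule u n) = sum_n (fun n => Im (u n)) n).
{ induction n as [|n IH]. now rewrite !sum_O. now rewrite !sum_Sn, <- IH. }
split.
- intros H. split; unfold is_series.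
  + apply (filterlim_ext (fun n => Re (@sum_n C_NormedModule u n)) _ HR).
    eapply filterlim_comp. apply H.
    intros P [e He]. exists e. intros y Hy. apply He, Hy.
  + apply (filterlim_ext (fun n => Im (@sum_n C_NormedModule u n)) _ HI).
    eapply filterlim_comp. apply H.
    intros P [e He]. exists e. intros y Hy. apply He, Hy.
- intros [H1 H2] P [e He].
  specialize (H1 _ (locally_ball (Re l) e)). specialize (H2 _ (locally_ball (Im l) e)).
  unfold filtermap in *. generalize (filter_and _ _ H1 H2). apply filter_imp.
  intros n [Ha Hb]. apply He. rewrite <- HR in Ha. rewrite <- HI in Hb. now split.
Qed.

(** * Complex differentiability of power series on the disk *)

Lemma ex_derive_C_quadratic (f : C -> C) (z d : C) (M : R) :
  in_disk z ->
  (forall w, in_disk w -> Cmod (f w - f z - (w - z) * d) <= M * Cmod (w - z) ^ 2) ->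
  @ex_derive C_AbsRing C_NormedModule f z.
Proof.
intros Hz Hf. exists d. split.
{ apply is_linear_scal_l. }
intros x Hx.
assert (Hxz : z = x).
{ apply (is_filter_lim_locally_unique (V := AbsRing_NormedModule C_AbsRing)). exact Hx. }
rewrite <- Hxz. intros eps. clear x Hx Hxz.
(* The first bound keeps [w] inside the disk. The second turns [M * Cmod (w - z) ^ 2] into at most
   [eps * Cmod (w - z)]; the denominator [Rabs M + 1] is positive whatever the sign of [M]. *)
assert (Hr : 0 < Rmin (1 - Cmod z) (eps / (Rabs M + 1))).
{ pose proof (Rabs_pos M). unfold in_disk in Hz. apply Rmin_glb_lt. lra.
  apply Rdiv_lt_0_compat. apply cond_pos. lra. }
exists (mkposreal _ Hr). intros w Hw.
assert (Hw' : Cmod (w - z) < Rmin (1 - Cmod z) (eps / (Rabs M + 1))) by exact Hw.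
clear Hw. rename Hw' into Hw.
assert (Hd : in_disk w).
{ unfold in_disk. replace w with (z + (w - z))%C by ring.
  eapply Rle_lt_trans. apply Cmod_triangle.
  pose proof (Rmin_l (1 - Cmod z) (eps / (Rabs M + 1))). lra. }
change (Cmod (f w - f z - (w - z) * d) <= eps * Cmod (w - z)).
eapply Rle_trans. now apply Hf.
simpl. rewrite Rmult_1_r, <- Rmult_assoc. apply Rmult_le_compat_r. apply Cmod_ge_0.
pose proof (Rmin_r (1 - Cmod z) (eps / (Rabs M + 1))).
assert (Cmod (w - z) <= eps / (Rabs M + 1)) by lra.
pose proof (Rabs_pos M). pose proof (Cmod_ge_0 (w - z)). pose proof (Rle_abs M).
apply Rle_trans with ((Rabs M + 1) * (eps / (Rabs M + 1))).
- nra.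
- right. field. lra.
Qed.

(** Built from two real [Series], which are total, so that no limit has to be chosen; by
    [is_series_C] it is the sum of the complex power series wherever that series converges. *)
Definition pseries_sum (a : nat -> C) (z : C) : C :=
  (Series (fun n => Re (Cpow z n * a n)), Series (fun n => Im (Cpow z n * a n))).

Lemma pow_n_Cpow (z : C) (n : nat) : @pow_n C_AbsRing z n = Cpow z n.
Proof. induction n as [|n IH]; simpl. reflexivity. now rewrite IH. Qed.

Lemma im_le_Cmod (c : C) : Rabs (Im c) <= Cmod c.
Proof. eapply Rle_trans; [|apply Rmax_Cmod]. apply Rmax_r. Qed.

Lemma Cmod_Cpow_le_1 (z : C) (n : nat) : Cmod z <= 1 -> Cmod (Cpow z n) <= 1.
Proof.
intros Hz. rewrite Cmod_pow, <- (pow1 n). apply pow_incr. split. apply Cmod_ge_0. apply Hz.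
Qed.

Lemma Cmod_term_le (a : nat -> C) (z : C) (n : nat) :
  Cmod z <= 1 -> Cmod (Cpow z n * a n) <= Cmod (a n).
Proof.
intros Hz. rewrite Cmod_mult.
pose proof (Cmod_Cpow_le_1 z n Hz). pose proof (Cmod_ge_0 (a n)). nra.
Qed.

Lemma is_pseries_sum (a : nat -> C) (z : C) :
  ex_series (fun n => Cmod (a n)) -> Cmod z <= 1 ->
  @is_pseries C_AbsRing C_NormedModule a z (pseries_sum a z).
Proof.
intros Ha Hz.
assert (H : @is_series C_AbsRing C_NormedModule (fun n => Cpow z n * a n)%C (pseries_sum a z)).
{ apply is_series_C; split; simpl; apply Series_correct;
  (apply @ex_series_le with (fun n => Cmod (a n)); [intros n|exact Ha]);
  apply Rle_trans with (Cmod (Cpow z n * a n)); try (now apply Cmod_term_le).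
  - apply (re_le_Cmod (Cpow z n * a n)).
  - apply (im_le_Cmod (Cpow z n * a n)). }
eapply is_series_ext; [|exact H]. intros n. now rewrite pow_n_Cpow.
Qed.

(** Induction on [n]: the remainders satisfy [E_(n+1) = w * E_n + n * z^(n-1) * (w - z)^2], and
    [n^2 + n <= (n+1)^2]. The bound is uniform on the closed disk, so it can be summed against the
    coefficients. *)
Lemma Cmod_Cpow_taylor (z w : C) (n : nat) : Cmod z <= 1 -> Cmod w <= 1 ->
  Cmod (Cpow w n - Cpow z n - (w - z) * (INR n * Cpow z (pred n)))
  <= INR n ^ 2 * Cmod (w - z) ^ 2.
Proof.
intros Hz Hw. induction n as [|n IH].
{ simpl. replace (1 - 1 - (w - z) * (0 * 1))%C with (RtoC 0) by ring.
  rewrite Cmod_0. lra. }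
set (E := (Cpow w n - Cpow z n - (w - z) * (INR n * Cpow z (pred n)))%C) in *.
assert (Hid : (Cpow w (S n) - Cpow z (S n) - (w - z) * (INR (S n) * Cpow z (pred (S n)))
   = w * E + (INR n * Cpow z (pred n)) * ((w - z) * (w - z)))%C).
(* The case [n = 0] is separate because [pred 0 = 0]; there the factor [INR 0] kills the spurious
   power. *)
{ unfold E. rewrite S_INR, RtoC_plus. destruct n as [|n]; simpl pred; rewrite ?Cpow_S.
  - simpl. ring.
  - ring. }
rewrite Hid. eapply Rle_trans. apply Cmod_triangle.
rewrite !Cmod_mult, Cmod_R, (Rabs_pos_eq _ (pos_INR n)).
pose proof (Cmod_Cpow_le_1 z (pred n) Hz) as H1.
pose proof (Cmod_ge_0 (Cpow z (pred n))). pose proof (Cmod_ge_0 w).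
pose proof (Cmod_ge_0 E). pose proof (pos_INR n). rewrite S_INR.
set (t := Cmod (w - z)) in *. assert (0 <= t * t) by nra.
assert (Cmod w * Cmod E <= 1 * (INR n ^ 2 * t ^ 2)) by (now apply Rmult_le_compat).
assert (INR n * Cmod (Cpow z (pred n)) * (t * t) <= INR n * 1 * (t * t)).
{ apply Rmult_le_compat_r; [easy|]. now apply Rmult_le_compat_l. }
nra.
Qed.

Lemma ex_series_of_weighted (u : nat -> R) :
  (forall n, 0 <= u n) -> ex_series (fun n => INR (S n) ^ 2 * u n) -> ex_series u.
Proof.
intros Hu Hs. eapply @ex_series_le; [|exact Hs]. intros n.
change (Rabs (u n) <= INR (S n) ^ 2 * u n).
rewrite Rabs_pos_eq by apply Hu. pose proof (Hu n).
assert (1 <= INR (S n) ^ 2).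
{ apply pow_R1_Rle. rewrite S_INR. pose proof (pos_INR n). lra. }
nra.
Qed.

Section PSeriesSum.
Variable a : nat -> C.
Hypothesis Ha : ex_series (fun n => INR (S n) ^ 2 * Cmod (a n)).

Let Ha1 : ex_series (fun n => Cmod (a n)).
Proof. apply ex_series_of_weighted; [intros n; apply Cmod_ge_0|exact Ha]. Qed.

(** The weight [(n+1)^2] in [Ha] dominates both the termwise derivative [d] and the remainders of
    [Cmod_Cpow_taylor]. Summing the latter gives a quadratic remainder for the whole series, with
    the sum in [Ha] as constant. *)
Lemma analytic_pseries_sum : analytic_on_disk (pseries_sum a).
Proof.
intros z Hz.
pose (d := fun n => (INR n * Cpow z (pred n) * a n)%C).
assert (Hd : exists l, @is_series C_AbsRing C_NormedModule d l).
{ apply (@ex_series_le C_AbsRing C_CompleteNormedModule) with (2 := Ha).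
  intros n. change (Cmod (d n) <= INR (S n) ^ 2 * Cmod (a n)).
  unfold d. rewrite !Cmod_mult, Cmod_R, (Rabs_pos_eq _ (pos_INR n)).
  apply Rmult_le_compat_r. apply Cmod_ge_0.
  pose proof (Cmod_Cpow_le_1 z (pred n) (Rlt_le _ _ Hz)). pose proof (pos_INR n).
  pose proof (Cmod_ge_0 (Cpow z (pred n))).
  rewrite S_INR. simpl. nra. }
destruct Hd as [l Hl].
apply ex_derive_C_quadratic with l (Series (fun n => INR (S n) ^ 2 * Cmod (a n))).
{ exact Hz. }
intros w Hw.
pose proof (is_pseries_sum a w Ha1 (Rlt_le _ _ Hw)) as Sw.
pose proof (is_pseries_sum a z Ha1 (Rlt_le _ _ Hz)) as Sz.
pose proof (is_series_minus _ _ _ _ (is_series_minus _ _ _ _ Sw Sz)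
   (is_series_scal_l (V := C_NormedModule) (w - z)%C _ _ Hl)) as SE.
pose proof (is_series_scal_l (K := R_AbsRing) (V := R_NormedModule) (Cmod (w - z) ^ 2) _ _
   (Series_correct _ Ha)) as SB.
rewrite Rmult_comm.
refine (norm_series_le (V := C_NormedModule) _ _ _ _ _ SE SB).
intros n. rewrite !pow_n_Cpow.
change (Cmod (Cpow w n * a n - Cpow z n * a n - (w - z) * d n)
  <= Cmod (w - z) ^ 2 * (INR (S n) ^ 2 * Cmod (a n))).
unfold d.
replace (Cpow w n * a n - Cpow z n * a n - (w - z) * (INR n * Cpow z (pred n) * a n))%C
  with ((Cpow w n - Cpow z n - (w - z) * (INR n * Cpow z (pred n))) * a n)%C by ring.
rewrite Cmod_mult, <- Rmult_assoc. apply Rmult_le_compat_r. apply Cmod_ge_0.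
eapply Rle_trans. apply Cmod_Cpow_taylor; now apply Rlt_le.
rewrite (Rmult_comm (Cmod (w - z) ^ 2)). apply Rmult_le_compat_r. apply pow2_ge_0.
apply pow_incr. split. apply pos_INR. apply le_INR. lia.
Qed.

Lemma taylor_pseries_sum : taylor_on_disk (pseries_sum a) a.
Proof.
intros z Hz. apply is_pseries_sum. apply Ha1. now apply Rlt_le.
Qed.

Lemma Cmod_pseries_sum_le (z : C) : Cmod z <= 1 ->
  Cmod (pseries_sum a z) <= Series (fun n => Cmod (a n)).
Proof.
intros Hz.
refine (norm_series_le (V := C_NormedModule) _ _ _ _ _
  (is_pseries_sum a z Ha1 Hz) (Series_correct _ Ha1)).
intros n. rewrite pow_n_Cpow. now apply Cmod_term_le.
Qed.

End PSeriesSum.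

(** * Taylor coefficients of a square, read off on the real segment *)

Lemma CV_radius_pos (b : nat -> R) (x : R) : 0 < x -> ex_pseries b x -> Rbar_lt 0 (CV_radius b).
Proof.
intros Hx Hb.
assert (H : Rbar_le x (CV_radius b)).
{ apply Rbar_not_lt_le. intros H. apply (CV_disk_outside b x).
  - now rewrite Rabs_pos_eq by lra.
  - apply ex_series_lim_0. apply ex_series_ext with (2 := Hb).
    intros n. unfold scal; simpl; unfold mult; simpl. rewrite pow_n_pow. ring. }
eapply Rbar_lt_le_trans; [|exact H]. exact Hx.
Qed.

Lemma Re_taylor (f : C -> C) (b : nat -> C) (x : R) :
  taylor_on_disk f b -> Rabs x < 1 -> is_pseries (fun n => Re (b n)) x (Re (f x)).
Proof.
intros Hf Hx. assert (Hd : in_disk x) by (unfold in_disk; now rewrite Cmod_R).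
destruct (proj1 (is_series_C _ _) (Hf x Hd)) as [H _].
eapply is_series_ext; [|exact H]. intros n.
change (Re (@pow_n C_AbsRing (RtoC x) n * b n) = @pow_n R_Ring x n * Re (b n)).
rewrite pow_n_Cpow, <- RtoC_pow, re_scal_l. reflexivity.
Qed.

(** Membership in H^2(beta) supplies some Taylor coefficients [b] of the square without saying
    which; this identifies their real parts with the Cauchy product, which is enough to bound
    [Cmod (b n)] from below. *)
Lemma Re_taylor_sqr (f : C -> C) (a : nat -> R) (b : nat -> C) :
  taylor_on_disk f (fun n => RtoC (a n)) ->
  taylor_on_disk (fun z => f z * f z)%C b ->
  forall n, Re (b n) = PS_mult a a n.
Proof.
intros Hf Hg.
(* On the real segment both sides are real power series, so Coquelicot's real
   identity theorem applies. *)
assert (Hex : forall x : R, Rabs x < 1 -> f x = RtoC (PSeries a x)).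
{ intros x Hx. assert (Hd : in_disk x) by (unfold in_disk; now rewrite Cmod_R).
  destruct (proj1 (is_series_C _ _) (Hf x Hd)) as [_ H].
  pose proof (Re_taylor f _ x Hf Hx) as H1.
  apply injective_projections.
  - change (Re (f x) = PSeries a x). symmetry. now apply is_pseries_unique.
  - change (Im (f x) = 0).
    assert (H0 : forall n, Im (@pow_n C_AbsRing (RtoC x) n * RtoC (a n)) = 0).
    { intros n. rewrite pow_n_Cpow, <- RtoC_pow, im_scal_l, im_RtoC. ring. }
    rewrite <- (is_series_unique _ _ H).
    erewrite is_series_unique; [|apply (is_series_single _ 0)]; intros; apply H0. }
assert (Ea : forall x : R, Rabs x < 1 -> is_pseries a x (PSeries a x)).
{ intros x Hx. pose proof (Re_taylor f _ x Hf Hx) as H. rewrite (Hex x Hx) in H. exact H. }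
assert (Ra : Rbar_lt 0 (CV_radius a)).
{ apply CV_radius_pos with (1/2). lra. eexists. apply Ea. rewrite Rabs_pos_eq; lra. }
assert (Rb : Rbar_lt 0 (CV_radius (fun n => Re (b n)))).
{ apply CV_radius_pos with (1/2). lra. eexists. apply (Re_taylor _ _ _ Hg).
  rewrite Rabs_pos_eq; lra. }
(* The Cauchy product is taken strictly inside the radius of convergence. Any small interval around
   0 will do, since the identity theorem is local at 0. *)
assert (Hr : exists r : posreal, r <= 1 /\ forall x, Rabs x < r -> Rbar_lt (Rabs x) (CV_radius a)).
{ destruct (CV_radius a) as [r| |] eqn:E; simpl in Ra; try easy.
  - assert (Hp : 0 < Rmin 1 r) by (apply Rmin_glb_lt; lra).
    exists (mkposreal _ Hp). split. apply Rmin_l. intros x Hx. simpl in *.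
    pose proof (Rmin_r 1 r). lra.
  - exists (mkposreal _ Rlt_0_1). simpl. split. lra. easy. }
destruct Hr as [r [Hr1 Hr]].
assert (Hm : forall x, Rabs x < r -> is_pseries (PS_mult a a) x (PSeries a x * PSeries a x)).
{ intros x Hx. apply is_pseries_mult; auto; apply Ea; lra. }
intros n. apply (PSeries_ext_recip (fun n => Re (b n)) (PS_mult a a) n); auto.
- apply CV_radius_pos with (r/2). pose proof (cond_pos r); lra. eexists. apply Hm.
  pose proof (cond_pos r). rewrite Rabs_pos_eq; lra.
- exists r. intros x Hx.
  assert (Hx' : Rabs x < r).
  { change (Rabs (x + - 0) < r) in Hx. now rewrite Ropp_0, Rplus_0_r in Hx. }
  rewrite (is_pseries_unique _ _ _ (Hm x Hx')).
  assert (Hx1 : Rabs x < 1) by lra.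
  rewrite (is_pseries_unique _ _ _ (Re_taylor _ _ _ Hg Hx1)).
  rewrite (Hex x Hx1), <- RtoC_mult. apply re_RtoC.
Qed.

(** * A growth condition on the weight that makes a composition operator unbounded *)

Lemma sum_f_R0_ge_term (u : nat -> R) (k N : nat) :
  (forall n, 0 <= u n) -> (k <= N)%nat -> u k <= sum_f_R0 u N.
Proof.
intros Hu. induction N as [|N IH]; intros Hk.
- replace k with 0%nat by lia. simpl. lra.
- simpl. destruct (Nat.eq_dec k (S N)) as [->|Hne].
  + pose proof (cond_pos_sum u N Hu). lra.
  + specialize (IH ltac:(lia)). pose proof (Hu (S N)). lra.
Qed.

Lemma sum_f_R0_le_series (u : nat -> R) (l : R) (N : nat) :
  (forall n, 0 <= u n) -> is_series u l -> sum_f_R0 u N <= l.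
Proof. intros Hu Hl. apply sum_incr; [|exact Hu]. now apply is_series_Reals. Qed.

Lemma square_in_H2 (beta : nat -> R) : in_H2 beta (fun z => z * z)%C.
Proof.
pose (e := fun n : nat => if Nat.eqb n 2 then RtoC 1 else RtoC 0).
exists (sqrt (Series (fun n => Cmod (e n) ^ 2 * beta n))). split.
- intros z Hz. apply ex_derive_C_quadratic with (z + z)%C 1. exact Hz.
  intros w _. replace (w * w - z * z - (w - z) * (z + z))%C with ((w - z) * (w - z))%C by ring.
  rewrite Cmod_mult. simpl. lra.
- exists e. split; [|split; [|reflexivity]].
  + intros z Hz. unfold is_pseries.
    replace (z * z)%C with (@scal C_AbsRing C_NormedModule (@pow_n C_AbsRing z 2) (e 2%nat)).
    * apply (is_series_single (V := C_NormedModule)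
        (fun k => @scal C_AbsRing C_NormedModule (@pow_n C_AbsRing z k) (e k)) 2).
      intros n Hn. unfold e. rewrite (proj2 (Nat.eqb_neq n 2) Hn). apply Cmult_0_r.
    * rewrite pow_n_Cpow. change (z * (z * 1) * 1 = z * z)%C. ring.
  + eexists. apply (is_series_single (V := R_NormedModule) (fun n => Cmod (e n) ^ 2 * beta n) 2).
    intros n Hn. unfold e. rewrite (proj2 (Nat.eqb_neq n 2) Hn), Cmod_0.
    change (0 ^ 2 * beta n = 0). ring.
Qed.

(** Boundedness already fails in its first clause: [z^2] lies in the space and its image [phi^2]
    does not. The factor [(n+1)^2] in the summability hypothesis serves the analyticity of [phi]. *)
Lemma square_of_symbol_unbounded (beta : nat -> R) :
  (forall n, 0 < beta n) ->
  ex_series (fun n => INR (S n) ^ 2 * / beta n) ->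
  (forall N : nat, exists n, (N <= n)%nat /\ beta n ^ 4 <= beta (2 * n)%nat) ->
  exists phi : C -> C,
    symbol phi /\
    in_H2 beta phi /\
    Rbar_lt (sup_norm phi) 1 /\
    ~ bounded_on_H2 beta (composition_operator phi).
Proof.
intros Hpos Hw Hinf.
assert (Hinv : forall n, 0 < / beta n) by (intros n; apply Rinv_0_lt_compat, Hpos).
assert (Hmod : forall c n, 0 < c -> Cmod (RtoC (c * / beta n)) = c * / beta n).
{ intros c n Hc. rewrite Cmod_R. apply Rabs_pos_eq. apply Rlt_le, Rmult_lt_0_compat; auto. }
assert (Hs : ex_series (fun n => / beta n)).
{ apply ex_series_of_weighted; [intros n; apply Rlt_le, Hinv|exact Hw]. }
pose (s := Series (fun n => / beta n)).
assert (Hs0 : 0 < s).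
{ apply Rlt_le_trans with (/ beta 0%nat). apply Hinv.
  apply (sum_f_R0_le_series (fun n => / beta n) s 0).
  - intros n. apply Rlt_le, Hinv.
  - now apply Series_correct. }
(* With this scaling, [Cmod (phi z) <= sum_n delta / beta n = 1/2]. *)
pose (delta := / (2 * s)).
assert (Hd : 0 < delta) by (apply Rinv_0_lt_compat; lra).
pose (a := fun n => delta * / beta n).
assert (Ha : forall n, 0 < a n) by (intros n; now apply Rmult_lt_0_compat).
pose (phi := pseries_sum (fun n => RtoC (a n))).
assert (Hca : ex_series (fun n => INR (S n) ^ 2 * Cmod (a n))).
{ eapply ex_series_ext; [|apply (ex_series_scal_l delta), Hw].
  intros n. unfold a. rewrite Hmod by easy.
  change (delta * (INR (S n) ^ 2 * / beta n) = INR (S n) ^ 2 * (delta * / beta n)). ring. }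
assert (Hphi : analytic_on_disk phi) by now apply analytic_pseries_sum.
assert (Htay : taylor_on_disk phi (fun n => RtoC (a n))) by now apply taylor_pseries_sum.
assert (Hbd : forall z, in_disk z -> Cmod (phi z) <= 1 / 2).
{ intros z Hz. eapply Rle_trans. apply Cmod_pseries_sum_le. exact Hca. now apply Rlt_le.
  right. rewrite (Series_ext _ (fun n => delta * / beta n)).
  - rewrite Series_scal_l. fold s. unfold delta. field. lra.
  - intros n. unfold a. now apply Hmod. }
exists phi. split; [|split; [|split]].
- split; [exact Hphi|split].
  + intros z Hz. specialize (Hbd z Hz). unfold in_disk. lra.
  (* All coefficients being positive, [phi (1/2)] is at least [a 0 + a 1 / 2], which exceeds
     [phi 0 = a 0]. *)
  + exists (RtoC 0), (RtoC (1/2)).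
    assert (H0 : Rabs 0 < 1) by (rewrite Rabs_R0; lra).
    assert (H1 : Rabs (1/2) < 1) by (rewrite Rabs_pos_eq; lra).
    split; [|split]; try (unfold in_disk; now rewrite Cmod_R).
    intros Heq.
    pose proof (Re_taylor _ _ _ Htay H0) as P0. pose proof (Re_taylor _ _ _ Htay H1) as P1.
    assert (E0 : Re (phi 0) = a 0%nat).
    { rewrite <- (is_pseries_unique _ _ _ P0). rewrite PSeries_0. apply re_RtoC. }
    apply is_pseries_R in P1.
    pose proof (sum_f_R0_le_series _ _ 1 (fun n => Rmult_le_pos _ _ (Rlt_le _ _ (Ha n)) (pow_le (1/2) n ltac:(lra))) P1) as H2.
    rewrite <- Heq, E0 in H2. simpl in H2. pose proof (Ha 1%nat). lra.
- eexists. split; [exact Hphi|]. exists (fun n => RtoC (a n)).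
  split; [exact Htay|split; [|reflexivity]].
  eapply ex_series_ext; [|apply (ex_series_scal_l (delta ^ 2)), Hs].
  intros n. unfold a. rewrite Hmod by easy.
  change (delta ^ 2 * / beta n = (delta * / beta n) ^ 2 * beta n). field. apply Rgt_not_eq, Hpos.
- apply Rbar_le_lt_trans with (1/2); [|simpl; lra].
  apply Lub_Rbar_correct. intros x [z [Hz ->]]. now apply Hbd.
- intros [H _]. destruct (H _ (square_in_H2 beta)) as [r [_ [b [Hb [Hsum _]]]]].
  pose proof (Re_taylor_sqr phi a b Htay Hb) as HRe.
  (* Terms of a convergent series are eventually below [delta ^ 4], the very level that the growth
     hypothesis forces at arbitrarily large indices [2 * n], through the middle term [k = n] of the
     Cauchy product. *)
  apply ex_series_lim_0 in Hsum. apply is_lim_seq_spec in Hsum.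
  assert (Hd4 : 0 < delta ^ 4) by now apply pow_lt.
  destruct (Hsum (mkposreal _ Hd4)) as [N HN]. simpl pos in HN.
  destruct (Hinf N) as [n [Hn Hgrow]].
  specialize (HN (2 * n)%nat ltac:(lia)).
  assert (Hge : a n * a n <= Cmod (b (2 * n)%nat)).
  { eapply Rle_trans; [|apply re_le_Cmod]. eapply Rle_trans; [|apply Rle_abs].
    rewrite HRe. unfold PS_mult.
    replace (a n * a n) with ((fun k => a k * a (2 * n - k)%nat) n).
    - apply (sum_f_R0_ge_term (fun k => a k * a (2 * n - k)%nat)); [|lia].
      intros k. apply Rlt_le, Rmult_lt_0_compat; apply Ha.
    - cbv beta. f_equal. f_equal. lia. }
  assert (Hab : delta ^ 4 <= (a n * a n) ^ 2 * beta (2 * n)%nat).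
  { apply Rle_trans with ((a n * a n) ^ 2 * beta n ^ 4).
    - right. unfold a. field. apply Rgt_not_eq, Hpos.
    - apply Rmult_le_compat_l; [apply pow2_ge_0|exact Hgrow]. }
  assert ((a n * a n) ^ 2 * beta (2 * n)%nat <= Cmod (b (2 * n)%nat) ^ 2 * beta (2 * n)%nat).
  { apply Rmult_le_compat_r; [apply Rlt_le, Hpos|]. apply pow_incr. split; [|exact Hge].
    apply Rlt_le, Rmult_lt_0_compat; apply Ha. }
  pose proof (Rle_abs (Cmod (b (2 * n)%nat) ^ 2 * beta (2 * n)%nat - 0)). lra.
Qed.

(** * The oscillating weight: growth under doubling, increments, summability *)

(* [ln 0 = 0] in Rocq, but the factor [sqrt (INR 0) = 0] makes this irrelevant. *)
Definition log_weight (n : nat) : R :=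
  sqrt (INR n) * (2 - cos (PI * (ln (INR n) / ln 2))).

Lemma ln_2_pos : 0 < ln 2.
Proof. rewrite <- ln_1. apply ln_increasing; lra. Qed.

Lemma sqrt_le_log_weight (n : nat) : sqrt (INR n) <= log_weight n.
Proof.
unfold log_weight.
pose proof (COS_bound (PI * (ln (INR n) / ln 2))). pose proof (sqrt_pos (INR n)). nra.
Qed.

Lemma log_weight_double (k : nat) :
  4 * log_weight (4 ^ k) <= log_weight (2 * 4 ^ k).
Proof.
pose proof ln_2_pos.
assert (H2 : 0 < 2 ^ k) by (apply pow_lt; lra).
assert (H4 : INR (4 ^ k) = 2 ^ k * 2 ^ k).
{ rewrite pow_INR, <- Rpow_mult_distr. f_equal. simpl. lra. }
unfold log_weight. rewrite mult_INR, sqrt_mult_alt by (simpl; lra). rewrite H4.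
replace (INR 2) with 2 by (simpl; lra).
rewrite sqrt_square by lra.
rewrite (ln_mult 2), ln_mult, ln_pow by nra.
replace (PI * ((INR k * ln 2 + INR k * ln 2) / ln 2)) with (0 + 2 * INR k * PI) by (field; lra).
replace (PI * ((ln 2 + (INR k * ln 2 + INR k * ln 2)) / ln 2)) with (PI + 2 * INR k * PI)
  by (field; lra).
rewrite !cos_period, cos_0, cos_PI.
(* The cosines are now 1 and -1, so the claim is [4 * 2^k <= 3 * sqrt 2 * 2^k]. *)
assert (4 / 3 <= sqrt 2).
{ rewrite <- (sqrt_square (4/3)) by lra. apply sqrt_le_1_alt. lra. }
nra.
Qed.

Lemma cos_lipschitz (x y : R) : Rabs (cos y - cos x) <= Rabs (y - x).
Proof.
destruct (MVT_gen cos x y (fun t => - sin t)) as [c [_ ->]].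
- intros t _. apply is_derive_cos.
- intros t _. apply continuity_cos.
- rewrite Rabs_mult, Rabs_Ropp.
  assert (Rabs (sin c) <= 1) by (apply Rabs_le, SIN_bound).
  pose proof (Rabs_pos (y - x)). nra.
Qed.

(** The increment splits in two. The growth of the square root, at most [1 / sqrt n], is multiplied
    by [2 - cos v <= 3]. The change of the cosine, at most [PI / (ln 2 * n)] because the logarithm
    grows by at most [1 / n], is multiplied by [sqrt n]. *)
Lemma log_weight_step (n : nat) : (0 < n)%nat ->
  Rabs (log_weight (S n) - log_weight n) <= (3 + PI / ln 2) * / sqrt (INR n).
Proof.
intros Hn. pose proof ln_2_pos. pose proof PI_RGT_0.
unfold log_weight. rewrite S_INR.
assert (Hx : 0 < INR n) by now apply lt_0_INR.
set (x := INR n) in *.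
set (u := PI * (ln x / ln 2)). set (v := PI * (ln (x + 1) / ln 2)).
assert (Hs : 0 < sqrt x) by now apply sqrt_lt_R0.
assert (Hss : sqrt x * sqrt x = x) by (apply sqrt_sqrt; lra).
set (i := / sqrt x). assert (Hi : i * sqrt x = 1) by (unfold i; field; lra).
assert (Hi0 : 0 < i) by now apply Rinv_0_lt_compat.
assert (Hsqrt : 0 <= sqrt (x + 1) - sqrt x <= i).
{ assert (sqrt x <= sqrt (x + 1)) by (apply sqrt_le_1_alt; lra).
  assert (sqrt (x + 1) * sqrt (x + 1) = x + 1) by (apply sqrt_sqrt; lra).
  split; [lra|]. apply Rmult_le_reg_r with (sqrt x); [easy|]. rewrite Hi. nra. }
assert (Hln : 0 <= ln (x + 1) - ln x <= / x).
{ split.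
  - pose proof (ln_le x (x + 1) Hx). lra.
  (* This is [1 + 1/x <= exp (1/x)] after taking logarithms. *)
  - rewrite <- ln_div by lra. rewrite <- (ln_exp (/ x)). apply ln_le.
    + apply Rdiv_lt_0_compat; lra.
    + eapply Rle_trans; [|apply exp_ineq1_le]. right. field. lra. }
assert (Hcos : Rabs (cos v - cos u) <= PI / ln 2 * / x).
{ eapply Rle_trans. apply cos_lipschitz.
  replace (v - u) with (PI / ln 2 * (ln (x + 1) - ln x)) by (unfold u, v; field; lra).
  assert (0 < PI / ln 2) by (apply Rdiv_lt_0_compat; lra).
  rewrite Rabs_pos_eq by nra. nra. }
replace (sqrt (x + 1) * (2 - cos v) - sqrt x * (2 - cos u))
  with ((sqrt (x + 1) - sqrt x) * (2 - cos v) + - (sqrt x * (cos v - cos u))) by ring.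
eapply Rle_trans. apply Rabs_triang.
rewrite Rabs_Ropp, !Rabs_mult, (Rabs_pos_eq (sqrt x)) by lra.
rewrite Rabs_pos_eq by apply Hsqrt. pose proof (COS_bound v).
rewrite Rabs_pos_eq by lra.
assert (Hii : / x = i * i) by (rewrite <- Hss, Rinv_mult; reflexivity).
assert (sqrt x * Rabs (cos v - cos u) <= PI / ln 2 * i).
{ replace (PI / ln 2 * i) with (sqrt x * (PI / ln 2 * / x)).
  - apply Rmult_le_compat_l; lra.
  - rewrite Hii. transitivity (PI / ln 2 * i * (i * sqrt x)); [ring|rewrite Hi; ring]. }
nra.
Qed.

(** Telescoping series, used as a comparison series of order [1 / n^2]. *)
Lemma ex_series_inv_mult_succ : ex_series (fun n => / (INR (S n) * INR (S (S n)))).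
Proof.
exists 1.
assert (H : forall n, 1 - / INR (S (S n)) = sum_n (fun n => / (INR (S n) * INR (S (S n)))) n).
{ induction n as [|n IH].
  - rewrite sum_O. simpl. field.
  - rewrite sum_Sn, <- IH.
    change (1 - / INR (S (S (S n))) = 1 - / INR (S (S n)) + / (INR (S (S n)) * INR (S (S (S n))))).
    rewrite !S_INR.
    pose proof (pos_INR n). field. lra. }
change (is_lim_seq (sum_n (fun n => / (INR (S n) * INR (S (S n))))) 1).
apply (is_lim_seq_ext _ _ _ H).
apply (is_lim_seq_minus _ _ 1 0 1).
- apply is_lim_seq_const.
- apply (is_lim_seq_inv _ p_infty); [|easy].
  apply (proj1 (is_lim_seq_incr_1 (fun n => INR (S n)) p_infty)).
  apply (proj1 (is_lim_seq_incr_1 INR p_infty)), is_lim_seq_INR.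
- simpl. unfold is_Rbar_minus, is_Rbar_plus. simpl. f_equal. f_equal. ring.
Qed.

(** With [t = sqrt n], the tangent bound gives [8 + t <= 8 * exp (t / 8)]. Its square dominates
    [t^2 + 1 = n + 1], and the fourth power of that turns [exp (t / 8)] into [exp t]. *)
Lemma pow4_le_exp_sqrt (n : nat) : INR (S n) ^ 4 <= 8 ^ 8 * exp (sqrt (INR n)).
Proof.
pose proof (pos_INR n). pose proof (sqrt_pos (INR n)) as Hs.
pose proof (sqrt_sqrt (INR n) ltac:(easy)) as Hss. set (t := sqrt (INR n)) in *.
replace (exp t) with (exp (t / 8) ^ 8).
2: { simpl. rewrite Rmult_1_r, <- !exp_plus. f_equal. field. }
rewrite <- Rpow_mult_distr.
replace 8%nat with (2 * 4)%nat by easy. rewrite pow_mult.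
apply pow_incr. rewrite S_INR, <- Hss. pose proof (exp_ineq1_le (t / 8)).
assert (8 + t <= 8 * exp (t / 8)) by lra. split; simpl; nra.
Qed.

(** With [x = n + 1], the bound [x^4 <= 8^8 * beta n] makes each term at most [8^8 / x^2]; the
    constant 2 in the comparison comes from [x + 1 <= 2 * x]. *)
Lemma ex_series_exp_log_weight : ex_series (fun n => INR (S n) ^ 2 * / exp (log_weight n)).
Proof.
apply (@ex_series_le R_AbsRing R_CompleteNormedModule)
  with (fun n => (2 * 8 ^ 8) * / (INR (S n) * INR (S (S n)))).
2: { apply (ex_series_scal_l (K := R_AbsRing) (V := R_NormedModule)), ex_series_inv_mult_succ. }
intros n. change (Rabs (INR (S n) ^ 2 * / exp (log_weight n))
  <= (2 * 8 ^ 8) * / (INR (S n) * INR (S (S n)))).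
pose proof (pow4_le_exp_sqrt n) as H4.
assert (He : exp (sqrt (INR n)) <= exp (log_weight n)).
{ destruct (sqrt_le_log_weight n) as [H|H]; [left; now apply exp_increasing|right; now rewrite H]. }
pose proof (exp_pos (log_weight n)). set (b := exp (log_weight n)) in *.
pose proof (pos_INR n). rewrite (S_INR (S n)).
assert (1 <= INR (S n)) by (rewrite S_INR; lra). set (x := INR (S n)) in *.
rewrite Rabs_pos_eq.
2: { apply Rmult_le_pos. apply pow2_ge_0. now apply Rlt_le, Rinv_0_lt_compat. }
apply Rmult_le_reg_r with (b * (x * (x + 1))). nra.
replace (x ^ 2 * / b * (b * (x * (x + 1)))) with (x ^ 3 * (x + 1)) by (field; lra).
replace (2 * 8 ^ 8 * / (x * (x + 1)) * (b * (x * (x + 1)))) with (2 * (8 ^ 8 * b)) by (field; lra).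
apply Rle_trans with (2 * x ^ 4).
- assert (0 <= x ^ 3) by (apply pow_le; lra).
  replace (2 * x ^ 4) with (x ^ 3 * (x + x)) by ring. nra.
- assert (0 < 8 ^ 8) by (apply pow_lt; lra). nra.
Qed.

Lemma log_weight_ratio :
  is_lim_seq (fun n => exp (log_weight (S n)) / exp (log_weight n)) 1.
Proof.
rewrite <- exp_0.
apply is_lim_seq_ext with (fun n => exp (log_weight (S n) - log_weight n)).
{ intros n. unfold Rminus. rewrite exp_plus, exp_Ropp. reflexivity. }
apply is_lim_seq_continuous.
{ apply derivable_continuous_pt, derivable_pt_exp. }
apply is_lim_seq_abs_0.
apply is_lim_seq_le_le_loc with (fun _ => 0) (fun n => (3 + PI / ln 2) * / sqrt (INR n)).
- exists 1%nat. intros n Hn. split. apply Rabs_pos. apply log_weight_step. lia.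
- apply is_lim_seq_const.
- rewrite <- (Rmult_0_r (3 + PI / ln 2)).
  apply (is_lim_seq_scal_l _ _ 0), (is_lim_seq_inv _ p_infty); [|easy].
  eapply filterlim_comp. apply is_lim_seq_INR. apply filterlim_sqrt_p.
Qed.

(** Since [log_weight] is nonnegative, every root [beta_n^(1/n)] is at least 1, and so is the lower
    limit. *)
Lemma weight_exp_log_weight : weight (fun n => exp (log_weight n)).
Proof.
split. intros n. apply exp_pos.
rewrite <- (LimInf_seq_const 1). apply LimInf_le. exists 0%nat. intros n _.
unfold Rpower. rewrite ln_exp.
destruct n as [|n].
- unfold log_weight. simpl. rewrite sqrt_0, Rmult_0_l, Rmult_0_r, exp_0. lra.
- eapply Rle_trans; [|apply exp_ineq1_le].
  pose proof (sqrt_le_log_weight (S n)). pose proof (sqrt_pos (INR (S n))).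
  assert (0 < / INR (S n)) by (apply Rinv_0_lt_compat, lt_0_INR; lia). nra.
Qed.

Theorem theorem2p11 :
  exists beta : nat -> R,
    weight beta /\
    ex_series (fun n => / beta n) /\
    is_lim_seq (fun n => beta (S n) / beta n) 1 /\
    exists phi : C -> C,
      symbol phi /\
      in_H2 beta phi /\
      Rbar_lt (sup_norm phi) 1 /\
      ~ bounded_on_H2 beta (composition_operator phi).
Proof.
exists (fun n => exp (log_weight n)).
split; [|split; [|split]].
- apply weight_exp_log_weight.
- apply ex_series_of_weighted.
  + intros n. apply Rlt_le, Rinv_0_lt_compat, exp_pos.
  + apply ex_series_exp_log_weight.
- apply log_weight_ratio.
- apply square_of_symbol_unbounded.
  + intros n. apply exp_pos.
  + apply ex_series_exp_log_weight.
  (* Powers of 4 are the indices where the cosine equals 1, and [4 ^ N] exceeds [N]; the fourth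
     power of the weight becomes a factor 4 on its logarithm. *)
  + intros N. exists (4 ^ N)%nat. split.
    { apply Nat.lt_le_incl, Nat.pow_gt_lin_r. lia. }
    replace (exp (log_weight (4 ^ N)) ^ 4) with (exp (4 * log_weight (4 ^ N))).
    2: { simpl. rewrite Rmult_1_r, <- !exp_plus. f_equal. ring. }
    destruct (log_weight_double N) as [H|H]; [left; now apply exp_increasing|right; now rewrite H].
Qed.
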